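(* Let $T$ be the tripod with limbs of length $1$, let $x_i=(i,1)\in T$ for $i=1,2,3$, and let $S$ be a subset of $T$. Then there exists an isometric embedding $U$ of $T$ into a Banach space $X$ such that $S=\mathbf{P}(\tilde x_0)$, where $\tilde x_0=\frac13\big(U(x_1)+U(x_2)+U(x_3)\big)$, if and only if there exist $i_0\in\{1,2,3\}$ and $0\le\alpha\le\beta\le 1/3$ such that either (i) $S=(i_0,[\alpha,\beta])$, or (ii) $S=(i_0,[0,\beta])\cup\bigcup_{i\ne i_0}(i,[0,\alpha])$.
   Context: The tripod $T$ with limbs of length $1$ consists of a center $o$ and the points $(i,t)$ with $i\in\{1,2,3\}$, $0<t\le 1$; $o$ is identified with $(i,0)$ for each $i$. Its metric is $d((i,t),(i,s))=|t-s|$ and $d((i,t),(j,s))=t+s$ for $i\ne j$ (so $d(o,(i,t))=t$). For $0\le\alpha\le\beta\le 1$, $(i,[\alpha,\beta])=\{(i,t):\alpha\le t\le\beta\}$. For an isometric embedding $U$ of $T$ into a normed space $X$ and $\tilde x\in X$, $\mathbf{P}(\tilde x)$ denotes the set of all points $x_0\in T$ for which there is a contractive (i.e. $1$-Lipschitz) retraction $\pi$ from $X$ onto $U(T)$ with $\pi(\tilde x)=U(x_0)$. Banach spaces are real. *)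

(* Defs.v *)
From HB Require Import structures.
From mathcomp Require Import all_boot all_order all_algebra.
From mathcomp Require Import all_classical all_reals all_analysis.
Set Implicit Arguments.
Unset Strict Implicit.
Unset Printing Implicit Defensive.
Import Order.TTheory GRing.Theory Num.Theory.
Import numFieldNormedType.Exports.
Local Open Scope classical_set_scope.
Local Open Scope ring_scope.

(* The limbs are indexed by 'I_3 = {0, 1, 2} instead of {1, 2, 3}. *)
Inductive tripod (R : realType) : Type :=
| tripod_center : tripod R
| tripod_limb : 'I_3 -> {t : R | 0 < t <= 1} -> tripod R.

Arguments tripod_center {R}.

(* The point (i, t) for 0 <= t <= 1, with (i, 0) the center (see tpoint0);
   the value is the center, by convention, for t outside [0, 1]. *)
Definition tpoint (R : realType) (i : 'I_3) (t : R) : tripod R :=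
  if insub t is Some u then tripod_limb i u else tripod_center.

Definition tdist (R : realType) (x y : tripod R) : R :=
  match x, y with
  | tripod_center, tripod_center => 0
  | tripod_center, tripod_limb _ s => val s
  | tripod_limb _ t, tripod_center => val t
  | tripod_limb i t, tripod_limb j s =>
      if i == j then `|val t - val s| else val t + val s
  end.

(* (i, [a, b]), meant for 0 <= a <= b <= 1. *)
Definition tsegment (R : realType) (i : 'I_3) (a b : R) : set (tripod R) :=
  [set tpoint i t | t in `[a, b]].

Definition isometric_embedding (R : realType) (X : normedModType R)
    (U : tripod R -> X) : Prop :=
  forall x y, `|U x - U y| = tdist x y.

Definition contractive_retraction (R : realType) (X : normedModType R)
    (A : set X) (pi : X -> X) : Prop :=
  [/\ forall x, A (pi x), forall x, A x -> pi x = x & 1.-lipschitz pi].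

Definition retract_values (R : realType) (X : normedModType R)
    (U : tripod R -> X) (x : X) : set (tripod R) :=
  [set x0 | exists2 pi : X -> X,
     contractive_retraction (range U) pi & pi x = U x0].

Lemma tpoint0 (R : realType) (i : 'I_3) : tpoint i (0 : R) = tripod_center.
Proof. by rewrite /tpoint insubF // ltxx. Qed.

Lemma tdist_tpoint (R : realType) (i j : 'I_3) (t s : R) :
  0 <= t <= 1 -> 0 <= s <= 1 ->
  tdist (tpoint i t) (tpoint j s) = if i == j then `|t - s| else t + s.
Proof.
move=> /andP[t0 t1] /andP[s0 s1].
move: t0 s0; rewrite !le_eqVlt => /predU1P[<-|t0] /predU1P[<-|s0].
- by rewrite !tpoint0 /= subrr normr0 addr0 if_same.
- have Hs : 0 < s <= 1 by rewrite s0.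
  by rewrite tpoint0 /tpoint insubT /= sub0r normrN add0r gtr0_norm // if_same.
- have Ht : 0 < t <= 1 by rewrite t0.
  by rewrite tpoint0 /tpoint insubT /= subr0 addr0 gtr0_norm // if_same.
- have Ht : 0 < t <= 1 by rewrite t0.
  have Hs : 0 < s <= 1 by rewrite s0.
  by rewrite /tpoint !insubT.
Qed.

(* Main.v *)
(* The tripod [T] is an injective metric space, so a point [y] of [T] is the value
   at [x] of a contractive retraction onto [U T] iff every distance from [y] to a
   point [z] of [T] is at most [`|x - U z|]; as geodesics of [T] extend to tips, it
   is enough that [z] ranges over the three tips. Hence [P(x)] depends only on the
   radii [r i], the distances from [x] to the tips: it contains [(i, s)] iff
   [1 - s <= r i] and [1 + s <= r j] for the other two [j]. At the barycentre the
   radii are at most [4/3], and any two of them add up to at least [2]; writing the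
   smallest as [1 + gamma], on limb [i0], and the next one as [1 + beta],
   [P(x)] is the segment [(i0, [- gamma, beta])] if [gamma <= 0], and has form (ii)
   with [alpha = gamma] if [gamma >= 0]. Conversely, all such [beta] and [gamma]
   are realized in a four-dimensional sup-normed space, with [U] linear on every
   limb. *)
Require Import Defs.
From HB Require Import structures.
From mathcomp Require Import all_boot all_order all_algebra.
From mathcomp Require Import all_classical all_reals all_analysis.
From mathcomp Require Import lra.
Import Order.TTheory GRing.Theory Num.Theory.
Import numFieldNormedType.Exports.
Local Open Scope classical_set_scope.
Local Open Scope ring_scope.

Lemma ler_dist_max {R : realDomainType} (a b c d D : R) :
  `|a - c| <= D -> `|b - d| <= D -> `|Num.max a b - Num.max c d| <= D.
Proof. by case: (leP a b) => ?; case: (leP c d) => ?; rewrite !ler_norml; lra. Qed.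

(** * Distances to the tips *)

Section Tripod.
Context {R : realType}.
Implicit Types (x y : tripod R) (i j : 'I_3) (s t : R) (r w : 'I_3 -> R).

Lemma tpointP x : exists i t, 0 <= t <= 1 /\ x = tpoint i t.
Proof.
case: x => [|i [t t01]]; first by exists ord0, 0; rewrite tpoint0 lexx ler01.
exists i, t; split; first by case/andP: t01 => /ltW -> ->.
by rewrite /tpoint insubT; congr tripod_limb; apply: val_inj.
Qed.

Lemma tdist_tip i j s : 0 <= s <= 1 ->
  tdist (tpoint i s) (tpoint j 1) = if i == j then 1 - s else s + 1.
Proof.
move=> s01; rewrite tdist_tpoint ?ler01 ?lexx//; case: eqP => // _.
by rewrite ler0_norm; lra.
Qed.

Lemma exists_other i : exists j, j != i.
Proof. by exists (i + 1); case: i => -[|[|[]]]. Qed.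

(** The geodesic from [x] to [y] continues outwards to the tip of the limb of [y], unless it runs
    inwards along that limb; then it continues through the center to any other tip. *)
Lemma tdist_geodesic x y :
  exists i, tdist x (tpoint i 1) = tdist x y + tdist y (tpoint i 1).
Proof.
have [j [s [s01 ->]]] := tpointP x; have [i [t [t01 ->]]] := tpointP y.
rewrite tdist_tpoint//; have [->|ji] := eqVneq j i; last first.
  exists i; rewrite !tdist_tip// eqxx (negbTE ji); lra.
have [st|ts] := leP s t.
  by exists i; rewrite !tdist_tip// eqxx ler0_norm; lra.
have [k ki] := exists_other i.
by exists k; rewrite !tdist_tip// eq_sym (negbTE ki) gtr0_norm; lra.
Qed.

(** * Retractions onto the tripod *)

Definition tip_balls r : set (tripod R) :=
  [set x | forall i, tdist x (tpoint i 1) <= r i].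

(** At the triple of the point [(j, t)] this is [t] for [i = j] and [- t] otherwise. Gaps of two
    different limbs never add up to more than 0, so at most one is positive. Halving makes each gap
    1-Lipschitz for the sup norm. *)
Definition limb_gap w i : R :=
  \big[Num.min/1]_(j | j != i) ((w i - w j) / 2).

(* The tripod embeds isometrically in the sup-normed space of triples by sending
   [y] to the triple of the [1 - tdist y (tpoint i 1)]; [tproj] is a contractive
   retraction of that embedding. *)
Definition tproj w : tripod R :=
  if [pick i | 0 < limb_gap w i] is Some i then tpoint i (limb_gap w i)
  else tripod_center.

Lemma limb_gap_le1 w i : limb_gap w i <= 1.
Proof. exact: bigmin_le_id. Qed.

Lemma limb_gap_le w i j : j != i -> limb_gap w i <= (w i - w j) / 2.
Proof. by move=> ji; exact: bigmin_le_cond. Qed.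

Lemma limb_gap_lipschitz w w' D i :
  (forall j, `|w j - w' j| <= D) -> limb_gap w i <= limb_gap w' i + D.
Proof.
move=> wD; rewrite -lerBlDr; apply/bigmin_geP; split=> [|j ji].
  have := limb_gap_le1 w i; have := le_trans (normr_ge0 _) (wD i); lra.
have := limb_gap_le w i j ji; have := wD i; have := wD j.
by rewrite !ler_norml => /andP[? ?] /andP[? ?]; lra.
Qed.

Lemma tproj_lipschitz w w' D :
  (forall i, `|w i - w' i| <= D) -> tdist (tproj w) (tproj w') <= D.
Proof.
move=> wD; have w'D i : `|w' i - w i| <= D by rewrite distrC.
have D0 : 0 <= D := le_trans (normr_ge0 _) (wD ord0).
have gap := limb_gap_lipschitz w w' D ^~ wD.
have gap' := limb_gap_lipschitz w' w D ^~ w'D.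
have gap01 v i : 0 < limb_gap v i -> 0 <= limb_gap v i <= 1.
  by move=> /ltW ->; rewrite limb_gap_le1.
rewrite /tproj; case: pickP => [i wi|w0]; case: pickP => [j wj|w'0].
- rewrite tdist_tpoint ?gap01//; case: eqVneq => [->|ij].
    by rewrite ler_norml; have := gap j; have := gap' j; lra.
  (* On different limbs the distance is the sum of the two gaps, at most half of
     [(w i - w' i) + (w' j - w j)]. *)
  have ji : j != i by rewrite eq_sym.
  have := limb_gap_le w i j ji; have := limb_gap_le w' j i ij.
  by have := wD i; have := wD j; rewrite !ler_norml; lra.
- rewrite -(tpoint0 R i) tdist_tpoint ?lexx ?ler01 ?gap01// eqxx.
  have := gap i; have := w'0 i; move/negbT; rewrite -leNgt ler_norml; lra.
- rewrite -(tpoint0 R j) tdist_tpoint ?lexx ?ler01 ?gap01// eqxx.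
  have := gap' j; have := w0 j; move/negbT; rewrite -leNgt ler_norml; lra.
- by rewrite /=.
Qed.

Lemma tprojK y : tproj (fun i => 1 - tdist y (tpoint i 1)) = y.
Proof.
set w := fun i => _; rewrite /tproj.
have [j [t [t01 yE]]] := tpointP y.
have wE i : w i = if j == i then t else - t.
  by rewrite /w yE tdist_tip//; case: eqP => _; lra.
have gapj : limb_gap w j = t.
  apply/le_anti/andP; split.
    have [k kj] := exists_other j; have := limb_gap_le w j k kj.
    by rewrite !wE eqxx eq_sym (negbTE kj); lra.
  apply/bigmin_geP; split=> [|k kj]; first by case/andP: t01.
  by rewrite !wE eqxx eq_sym (negbTE kj); lra.
case: pickP => [i wi|w0].
  have [->|ij] := eqVneq i j; first by rewrite gapj yE.
  have ji : j != i by rewrite eq_sym.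
  have := limb_gap_le w i j ji; rewrite !wE eqxx (negbTE ji) => ?; exfalso; lra.
have := w0 j; move/negbT; rewrite gapj -leNgt => t0.
by have -> : y = tpoint j 0; [rewrite yE; congr tpoint; lra|rewrite tpoint0].
Qed.

(* Each coordinate [1 - `|z - U (tpoint i 1)|] extends that of the tripod to [X];
   raising it to a cone with vertex [x] prescribes the value at [x] without
   affecting the values on the tripod. *)
Lemma retract_valuesE {X : normedModType R} (U : tripod R -> X) (x : X) :
  isometric_embedding U ->
  retract_values U x = tip_balls (fun i => `|x - U (tpoint i 1)|).
Proof.
move=> isoU; apply/seteqP; split=> [y [p [_ pU plip] px]|y yr].
  move=> i; rewrite -isoU -px -{1}(pU (U (tpoint i 1))); last by exists (tpoint i 1).
  by have := plip (x, U (tpoint i 1)) (conj I I); rewrite /= mul1r.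
have {}yr z : `|U y - U z| <= `|x - U z|.
  have [i iE] := tdist_geodesic y z.
  have := yr i; rewrite iE -!isoU.
  have := ler_distD (U z) x (U (tpoint i 1)); lra.
pose w z i := Num.max (1 - `|z - U (tpoint i 1)|)
                      (1 - `|U y - U (tpoint i 1)| - `|z - x|).
have wU z : w (U z) = (fun i => 1 - tdist z (tpoint i 1)).
  apply/funext => i; rewrite /w -isoU; apply/max_idPl.
  by have := yr z; have := ler_distD (U y) (U z) (U (tpoint i 1));
    rewrite (distrC (U z) x) (distrC (U z) (U y)); lra.
have wx : w x = (fun i => 1 - tdist y (tpoint i 1)).
  apply/funext => i; rewrite /w -isoU subrr normr0 subr0; apply/max_idPr.
  by have := yr (tpoint i 1); lra.
exists (fun z => U (tproj (w z))); last by rewrite wx tprojK.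
split=> [z|_ [z _ <-]|[z z'] _]; first by exists (tproj (w z)).
  by rewrite wU tprojK.
rewrite /= mul1r isoU; apply: tproj_lipschitz => i.
have dist_contractive v : `| `|z - v| - `|z' - v| | <= `|z - z'|.
  by apply: le_trans (ler_dist_dist _ _) _; rewrite opprB addrA subrK.
apply: ler_dist_max.
  by have := dist_contractive (U (tpoint i 1)); rewrite !ler_norml; clear; lra.
by have := dist_contractive x; rewrite !ler_norml; clear; lra.
Qed.

(** * Intersections of balls about the tips *)

Lemma mem_tip_balls r i s : 0 <= s <= 1 ->
  tip_balls r (tpoint i s) <->
  1 - s <= r i /\ forall j, j != i -> s + 1 <= r j.
Proof.
move=> s01; split=> [H|[Hi Hj] j].
  split=> [|j ji]; first by have := H i; rewrite tdist_tip// eqxx.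
  by have := H j; rewrite tdist_tip// eq_sym (negbTE ji).
rewrite tdist_tip//; have [<-//|ij] := eqVneq i j.
by apply: Hj; rewrite eq_sym.
Qed.

Definition radii_spec r i0 (beta gamma : R) :=
  [/\ r i0 = 1 + gamma, exists2 i, i != i0 & r i = 1 + beta &
      forall i, i != i0 -> 1 + beta <= r i].

Lemma mem_tip_balls_near {r i0} {beta gamma : R} {s} :
  radii_spec r i0 beta gamma -> - beta <= gamma -> 0 <= s <= 1 ->
  tip_balls r (tpoint i0 s) <-> - gamma <= s <= beta.
Proof.
move=> [r0 [i1 i10 r1] rge] gb s01; rewrite mem_tip_balls// r0.
split=> [[? /(_ _ i10)]|?]; first by rewrite r1; lra.
by split=> [|j /rge]; lra.
Qed.

(** Off limb [i0] the smallest ball, about the tip of [i0], is the binding one; the others have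
    radius at least [1 + beta], where [beta >= gamma] and [beta >= 0]. *)
Lemma mem_tip_balls_far {r i0} {beta gamma : R} {i s} :
  radii_spec r i0 beta gamma -> - beta <= gamma -> gamma <= beta ->
  i != i0 -> 0 <= s <= 1 -> tip_balls r (tpoint i s) <-> s <= gamma.
Proof.
move=> [r0 _ rge] bg gb ii0 s01; rewrite mem_tip_balls//.
split=> [[_ /(_ i0)]|sg]; first by rewrite r0 eq_sym => /(_ ii0); lra.
split=> [|j ji]; first by have := rge _ ii0; lra.
by have [->|/rge] := eqVneq j i0; rewrite ?r0; lra.
Qed.

Lemma tip_balls_segment {r i0} {beta gamma : R} :
  radii_spec r i0 beta gamma -> - beta <= gamma -> gamma <= 0 -> beta <= 3^-1 ->
  tip_balls r = tsegment i0 (- gamma) beta.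
Proof.
move=> rP bg g0 b3; have gb : gamma <= beta by lra.
apply/seteqP; split=> [y|y [s /=]]; last first.
  by rewrite in_itv/= => sgb <-; apply/(mem_tip_balls_near rP bg); lra.
have [i [s [s01 ->]]] := tpointP y; have [->|ii0] := eqVneq i i0.
  by move/(mem_tip_balls_near rP bg s01) => ?; exists s; rewrite //= in_itv.
(* From [0 <= s <= gamma <= 0] the point is the center and [gamma = 0], so the segment starts at the
   center. *)
move/(mem_tip_balls_far rP bg gb ii0 s01) => sg; exists 0; last first.
  by have -> : s = 0 by [lra]; rewrite !tpoint0.
by rewrite /= in_itv/=; lra.
Qed.

Lemma tip_balls_tripod {r i0} {beta gamma : R} :
  radii_spec r i0 beta gamma -> 0 <= gamma -> gamma <= beta -> beta <= 3^-1 ->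
  tip_balls r = tsegment i0 0 beta `|`
    \bigcup_(i in [set i | i != i0]) tsegment i 0 gamma.
Proof.
move=> rP g0 gb b3; have bg : - beta <= gamma by lra.
apply/seteqP; split=> [y|y [[s /=]|[i /= ii0 [s /=]]]].
- have [i [s [s01 ->]]] := tpointP y; have [->|ii0] := eqVneq i i0.
    move/(mem_tip_balls_near rP bg s01) => ?; left; exists s => //=.
    by rewrite in_itv/=; lra.
  move/(mem_tip_balls_far rP bg gb ii0 s01) => sg; right; exists i => //.
  by exists s => //=; rewrite in_itv/=; lra.
- by rewrite in_itv/= => sb <-; apply/(mem_tip_balls_near rP bg); lra.
- by rewrite in_itv/= => sg <-; apply/(mem_tip_balls_far rP bg gb ii0); lra.
Qed.

Lemma tip_balls_shape r :
  (forall i, r i <= 1 + 3^-1) -> (forall i j, i != j -> 2 <= r i + r j) ->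
  exists i0 alpha beta, [/\ 0 <= alpha, alpha <= beta & beta <= 3^-1] /\
    (tip_balls r = tsegment i0 alpha beta \/
     tip_balls r = tsegment i0 0 beta `|`
       \bigcup_(i in [set i | i != i0]) tsegment i 0 alpha).
Proof.
move=> rle rr.
pose i0 := [arg min_(i < ord0) r i]%O.
have r0 i : r i0 <= r i by rewrite /i0; case: arg_minP => // k _; apply.
have [k ki0] := exists_other i0.
have [i1 i10 r1] : exists2 i1, i1 != i0 & forall i, i != i0 -> r i1 <= r i.
  by case: (@arg_minP _ _ _ k (fun i => i != i0) r ki0) => i1 i10 r1; exists i1.
pose beta := r i1 - 1; pose gamma := r i0 - 1.
have rP : radii_spec r i0 beta gamma.
  split=> [||i /r1]; rewrite /beta /gamma ?subrKC//.
  by exists i1 => //; lra.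
have b3 : beta <= 3^-1 by have := rle i1; rewrite /beta; lra.
have bg : - beta <= gamma by have := rr _ _ i10; rewrite /beta /gamma; lra.
have gb : gamma <= beta by have := r0 i1; rewrite /beta /gamma; lra.
have [g0|/ltW g0] := leP gamma 0.
  exists i0, (- gamma), beta; split; first by split; lra.
  by left; exact: tip_balls_segment rP bg g0 b3.
exists i0, gamma, beta; split; first by split; lra.
by right; exact: tip_balls_tripod rP g0 gb b3.
Qed.

End Tripod.

(** * Embeddings into row vectors, a Banach space under the sup norm *)

HB.instance Definition _ (R : realType) (m n : nat) := Complete.on 'M[R]_(m, n).

Section SupNorm.
Context {R : realType} {n : nat}.
Implicit Type v : 'rV[R]_n.

Lemma rV_norm_ge v k : `|v ord0 k| <= `|v|.
Proof.
rewrite [leRHS]/Num.Def.normr /= mx_normrE; apply/bigmax_geP; right.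
by exists (ord0, k).
Qed.

Lemma rV_norm_le v c : 0 <= c -> (forall k, `|v ord0 k| <= c) -> `|v| <= c.
Proof.
move=> c0 vc; rewrite [leLHS]/Num.Def.normr /= mx_normrE; apply/bigmax_leP.
by split=> // -[i k] _; rewrite (ord1 i).
Qed.

Definition star (V : 'I_3 -> 'rV[R]_n) (x : tripod R) : 'rV[R]_n :=
  if x is tripod_limb i t then val t *: V i else 0.

Lemma starE V i t : 0 <= t <= 1 -> star V (tpoint i t) = t *: V i.
Proof.
move=> /andP[]; rewrite le_eqVlt => /predU1P[<- _|t0 t1].
  by rewrite tpoint0 scale0r.
by rewrite /tpoint insubT ?t0.
Qed.

(** Each [V i] is a unit vector. For two limbs, entries bounded by 1 with product -1 are 1 and -1,
    so at that coordinate [t *: V i - s *: V j] attains its largest possible modulus [t + s]. *)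
Lemma star_isometric (V : 'I_3 -> 'rV[R]_n) :
  (forall i k, `|V i ord0 k| <= 1) ->
  (forall i, exists k, `|V i ord0 k| = 1) ->
  (forall i j, i != j -> exists k, V i ord0 k * V j ord0 k = - 1) ->
  isometric_embedding (star V).
Proof.
move=> V1 Vi Vij x y.
have [i [t [t01 ->]]] := tpointP x; have [j [s [s01 ->]]] := tpointP y.
rewrite !starE// tdist_tpoint//; have [->|ij] := eqVneq i j.
  rewrite -scalerBl normrZ -[RHS]mulr1; congr (_ * _); apply/le_anti/andP; split.
    exact: rV_norm_le.
  by have [k <-] := Vi j; exact: rV_norm_ge.
apply/le_anti/andP; split.
  apply: rV_norm_le => [|k]; first lra.
  rewrite !mxE; have := V1 i k; have := V1 j k.
  by rewrite !ler_norml; nra.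
have [k Vk] := Vij _ _ ij.
have := rV_norm_ge (t *: V i - s *: V j) k; apply: le_trans.
rewrite !mxE; have := V1 i k; have := V1 j k; rewrite !ler_norml => ? ?.
have [a1|a1] := leP 0 (V i ord0 k).
  have [-> ->] : V i ord0 k = 1 /\ V j ord0 k = -1 by split; nra.
  by rewrite ler_normr; lra.
have [-> ->] : V i ord0 k = -1 /\ V j ord0 k = 1 by split; nra.
by rewrite ler_normr; lra.
Qed.

End SupNorm.

(* The barycentre of the three limb directions is
   [(beta, 0, - beta, - gamma)]. The first three coordinates separate the three
   pairs of limbs, the first and third also put the tips [1] and [2] at distance
   [1 + beta] from the barycentre, and the fourth puts the tip [0] at distance
   [1 + gamma]. *)
Definition limb_direction {R : realType} (beta gamma : R) (i : 'I_3) : 'rV[R]_4 :=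
  let q := - (3 * gamma + 1) / 2 in
  \row_k nth 0 (nth [::] [:: [:: 1; 0; - 1; 1];
                             [:: - 1; 1; - (3 * beta); q];
                             [:: 3 * beta; - 1; 1; q]] i) k.

Lemma limb_direction_isometric {R : realType} (beta gamma : R) i0 :
  beta <= 3^-1 -> - beta <= gamma -> gamma <= beta ->
  isometric_embedding (star (fun i => limb_direction beta gamma (i - i0))).
Proof.
move=> b3 bg gb.
have b0 : 0 <= beta by lra.
apply: star_isometric => [i k|i|i j ij].
(* The bound [beta <= 3^-1] keeps [3 * beta] and [q] within [[-1, 1]]. *)
- rewrite mxE; case: (i - i0) => -[|[|[|//]]] ? /=;
    case: k => -[|[|[|[|//]]]] ? /=; rewrite ler_norml; lra.
- case: (i - i0) => -[|[|[|//]]] ? /=.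
  + by exists (inord 0); rewrite mxE inordK //= normr1.
  + by exists (inord 1); rewrite mxE inordK //= normr1.
  + by exists (inord 1); rewrite mxE inordK //= normrN1.
- have : i - i0 != j - i0 by rewrite (inj_eq (addIr _)).
  case: (i - i0) => -[|[|[|//]]] ?; case: (j - i0) => -[|[|[|//]]] ? // _.
  + by exists (inord 0); rewrite !mxE inordK //= mul1r.
  + by exists (inord 2); rewrite !mxE inordK //= mulr1.
  + by exists (inord 0); rewrite !mxE inordK //= mulr1.
  + by exists (inord 1); rewrite !mxE inordK //= mul1r.
  + by exists (inord 2); rewrite !mxE inordK //= mul1r.
  + by exists (inord 1); rewrite !mxE inordK //= mulr1.
Qed.

Lemma limb_direction_radius {R : realType} (beta gamma : R) i :
  beta <= 3^-1 -> - beta <= gamma -> gamma <= beta ->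
  `|3^-1 *: \sum_j limb_direction beta gamma j - limb_direction beta gamma i| =
  1 + if i == 0 then gamma else beta.
Proof.
move=> b3 bg gb.
have b0 : 0 <= beta by lra.
apply/le_anti/andP; split.
  apply: rV_norm_le => [|k]; first by case: ifP; lra.
  rewrite !mxE summxE !big_ord_recl big_ord0 !mxE /=.
  case: i => -[|[|[|//]]] ?; case: k => -[|[|[|[|//]]]] ? /=;
    rewrite ler_norml; lra.
case: i => -[|[|[|//]]] ? /=.
- apply: le_trans (rV_norm_ge _ (inord 3)).
  rewrite !mxE summxE !big_ord_recl big_ord0 !mxE inordK //= ler_normr; lra.
- apply: le_trans (rV_norm_ge _ (inord 0)).
  rewrite !mxE summxE !big_ord_recl big_ord0 !mxE inordK //= ler_normr; lra.
- apply: le_trans (rV_norm_ge _ (inord 2)).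
  rewrite !mxE summxE !big_ord_recl big_ord0 !mxE inordK //= ler_normr; lra.
Qed.

Lemma exists_embedding_radii {R : realType} (beta gamma : R) i0 :
  beta <= 3^-1 -> - beta <= gamma -> gamma <= beta ->
  exists (X : completeNormedModType R) (U : tripod R -> X),
    isometric_embedding U /\
    retract_values U (3^-1 *: \sum_(i < 3) U (tpoint i 1)) =
    tip_balls (fun i => 1 + if i == i0 then gamma else beta).
Proof.
move=> b3 bg gb; set V := limb_direction beta gamma.
(* Subtraction modulo 3 rotates the limbs so that [i0] gets direction 0; the barycentre is
   unchanged. *)
exists 'rV[R]_4, (star (fun i => V (i - i0))).
have iso := limb_direction_isometric _ _ i0 b3 bg gb; split=> //.
rewrite retract_valuesE//; congr tip_balls; apply/funext => i.
rewrite -subr_eq0 -limb_direction_radius//.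
have tipE j : star (fun i => V (i - i0)) (tpoint j 1) = V (j - i0).
  by rewrite starE ?scale1r// ler01 lexx.
rewrite tipE (eq_bigr _ (fun j _ => tipE j)).
by rewrite [in RHS](reindex_inj (addIr (- i0))).
Qed.

(** * Radii at the barycentre, and the equivalence *)

Lemma barycenter_dist_le {R : realType} {X : normedModType R}
    (U : tripod R -> X) i : isometric_embedding U ->
  `|3^-1 *: \sum_(j < 3) U (tpoint j 1) - U (tpoint i 1)| <= 1 + 3^-1.
Proof.
move=> isoU.
have -> : 3^-1 *: \sum_(j < 3) U (tpoint j 1) - U (tpoint i 1) =
    3^-1 *: \sum_(j < 3) (U (tpoint j 1) - U (tpoint i 1)).
  rewrite sumrB sumr_const card_ord scalerBr -(scaler_nat 3 (U _)) scalerA.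
  by rewrite mulVf ?scale1r// pnatr_eq0.
rewrite normrZ gtr0_norm//.
(* The tip [i] is at distance 0 from itself and 2 from the other two, so the norms add up to 4. *)
have -> : 1 + 3^-1 = 3^-1 * 4 :> R by lra.
rewrite ler_pM2l//; apply: le_trans (ler_norm_sum _ _ _) _.
under eq_bigr do rewrite isoU tdist_tip ?ler01 ?lexx//.
rewrite !big_ord_recl big_ord0.
by case: i => -[|[|[|//]]] ? /=; lra.
Qed.

Theorem theorem4p8 (R : realType) (S : set (tripod R)) :
  (exists (X : completeNormedModType R) (U : tripod R -> X),
     isometric_embedding U /\
     S = retract_values U (3^-1 *: \sum_(i < 3) U (tpoint i 1)))
  <->
  (exists (i0 : 'I_3) (alpha beta : R),
     [/\ 0 <= alpha, alpha <= beta & beta <= 3^-1] /\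
     (S = tsegment i0 alpha beta \/
      S = tsegment i0 0 beta `|`
          \bigcup_(i in [set i | i != i0]) tsegment i 0 alpha)).
Proof.
split=> [[X [U [isoU ->]]]|[i0 [alpha [beta [[alpha0 alphab beta1] SE]]]]].
  rewrite retract_valuesE//; apply: tip_balls_shape => [i|i j ij].
    exact: barycenter_dist_le.
  (* Two tips are at distance 2, so their distances to [x] add up to at least 2. *)
  set x := 3^-1 *: _.
  have := ler_distD x (U (tpoint i 1)) (U (tpoint j 1)).
  rewrite isoU tdist_tip ?ler01 ?lexx// (negbTE ij) (distrC _ x); lra.
have spec gamma : radii_spec (fun i => 1 + if i == i0 then gamma else beta)
    i0 beta gamma.
  have [i1 i10] := exists_other i0.
  split; rewrite ?eqxx//; last by move=> i /negbTE ->.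
  by exists i1; rewrite ?(negbTE i10).
(* Form (i) is realized with [gamma = - alpha], form (ii) with [gamma = alpha]. *)
case: SE => ->.
  have [X [U [isoU UE]]] :=
    exists_embedding_radii beta (- alpha) i0 beta1 ltac:(lra) ltac:(lra).
  exists X, U; split=> //.
  by rewrite UE (tip_balls_segment (spec _)) ?opprK//; lra.
have [X [U [isoU UE]]] :=
  exists_embedding_radii beta alpha i0 beta1 ltac:(lra) ltac:(lra).
by exists X, U; split=> //; rewrite UE (tip_balls_tripod (spec _)).
Qed.
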